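(* Let $f$ satisfy Assumption A, $g$ satisfy Assumption B, $L>L_f$ and $1/L>s_0$. Let $(u_k)$ be a sequence of proximal gradient iterates with parameter $L$ and let $u_{k_n}\rightharpoonup u^*$ weakly in $L^2(\Omega)$ for some subsequence. Assume $\nabla f(u_{k_n})(x)\to\nabla f(u^* )(x)$ for almost every $x\in\Omega$. Then for almost all $x\in\Omega$, \[ u^*(x)\in\big(\mathcal{G}^0\cup\operatorname{conv}^\infty\mathcal{G}^+\cup\operatorname{conv}^\infty\mathcal{G}^-\big)\big(-\nabla f(u^* )(x)\big). \]
   Context: $\Omega\subset\mathbb{R}^n$ Lebesgue measurable with finite measure. Assumption A: $f:L^2(\Omega)\to\mathbb{R}$ bounded below, weakly lower semicontinuous, Fréchet differentiable, $\nabla f$ Lipschitz with constant $L_f$. Assumption B on $g:\mathbb{R}\to\mathbb{R}\cup\{+\infty\}$: (B1) lsc, symmetric, $g(0)=0$; (B2) $g(u)<\infty$ for some $u\ne0$; (B3) one of (B3a) $g$ twice differentiable on some $(0,\epsilon)$, $\limsup_{u\searrow0}g''(u)\in(-\infty,0)$; (B3b) same differentiability, $\lim_{u\searrow0}g''(u)=-\infty$; (B3c) $\liminf_{u\searrow0}g(u)>0$; (B4) $g\ge0$. $s_0:=0$ if (B3b) or (B3c) holds, otherwise $s_0:=-1/\limsup_{u\searrow0}g''(u)$. Proximal gradient iterates with parameter $L>0$: $(u_k)_{k\ge0}\subset L^2(\Omega)$, arbitrary $u_0$, each $u_{k+1}$ a global minimizer over $L^2(\Omega)$ of $f(u_k)+\int_\Omega\nabla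 f(u_k)(u-u_k)\,dx+\frac L2\|u-u_k\|^2_{L^2(\Omega)}+\int_\Omega g(u(x))\,dx$. $\mathcal{G}_L:\mathbb{R}\rightrightarrows\mathbb{R}$: $u\in\mathcal{G}_L(z)$ iff $u$ is a global minimizer of $v\mapsto -zv+\frac L2(v-u)^2+g(v)$; $\mathcal{G}^+(z):=\mathcal{G}_L(z)\cap(0,\infty)$, $\mathcal{G}^-(z):=\mathcal{G}_L(z)\cap(-\infty,0)$, $\mathcal{G}^0(z):=\mathcal{G}_L(z)\cap\{0\}$; unions of set-valued maps are taken pointwise. For $F:\mathbb{R}\rightrightarrows\mathbb{R}$, $(\operatorname{conv}^\infty F)(x):=\limsup_{k\to\infty}\operatorname{conv}\big(\bigcup_{|x'-x|<1/k}F(x')\big)$, where $\operatorname{conv}$ is the convex hull and the outer limit $\limsup_k A_k$ is the set of all limits of sequences $y_{k_j}\in A_{k_j}$ along subsequences. *)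

(* Defs.v *)
From HB Require Import structures.
From mathcomp Require Import all_boot all_order all_algebra.
From mathcomp Require Import all_classical all_reals all_analysis.

Set Implicit Arguments.
Unset Strict Implicit.
Unset Printing Implicit Defensive.
Import Order.TTheory GRing.Theory Num.Theory Num.Def.
Import numFieldNormedType.Exports.

Local Open Scope classical_set_scope.
Local Open Scope ring_scope.

(* L^2(Omega) modelled by functions T -> R on a measurable set Omega   *)
(* of a measure space (T, mu); all integrals are over Omega.          *)
Section L2.
Context {d : measure_display} {T : measurableType d} {R : realType}.
Variables (mu : {measure set T -> \bar R}) (Om : set T).

Definition inL2 (u : T -> R) : Prop :=
  measurable_fun Om u /\
  (\int[mu]_(x in Om) ((u x) ^+ 2)%:E < +oo)%E.

Definition L2inner (u v : T -> R) : R :=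
  fine (\int[mu]_(x in Om) (u x * v x)%:E)%E.

Definition L2norm (u : T -> R) : R :=
  Num.sqrt (fine (\int[mu]_(x in Om) ((u x) ^+ 2)%:E)%E).

Definition L2weak_cvg (w : nat -> T -> R) (u : T -> R) : Prop :=
  forall v, inL2 v -> L2inner (w n) v @[n --> \oo] --> L2inner u v.

(* Assumption A, with the Riesz representative gradf of the Frechet
   derivative and Lipschitz constant Lf *)
Definition assumptionA (f : (T -> R) -> R) (gradf : (T -> R) -> (T -> R))
    (Lf : R) : Prop :=
  (exists c : R, forall u, inL2 u -> c <= f u) /\
  (forall (w : nat -> T -> R) u, (forall n, inL2 (w n)) -> inL2 u ->
     L2weak_cvg w u ->
     forall e : R, 0 < e -> \forall n \near \oo, f u - e <= f (w n)) /\
  (forall u, inL2 u -> inL2 (gradf u) /\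
     forall e : R, 0 < e -> exists2 delta : R, 0 < delta &
       forall h, inL2 h -> L2norm h < delta ->
         `| f (u \+ h) - f u - L2inner (gradf u) h | <= e * L2norm h) /\
  0 <= Lf /\
  (forall u v, inL2 u -> inL2 v ->
     L2norm (gradf u \- gradf v) <= Lf * L2norm (u \- v)).

Definition prox_model (g : R -> \bar R) (f : (T -> R) -> R)
    (gradf : (T -> R) -> (T -> R)) (L : R) (uk v : T -> R) : \bar R :=
  ((f uk + L2inner (gradf uk) (v \- uk) + L / 2 * L2norm (v \- uk) ^+ 2)%:E
   + \int[mu]_(x in Om) g (v x))%E.

Definition prox_grad_iterates (g : R -> \bar R) (f : (T -> R) -> R)
    (gradf : (T -> R) -> (T -> R)) (L : R) (u : nat -> T -> R) : Prop :=
  (forall k, inL2 (u k)) /\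
  (forall k v, inL2 v ->
     (prox_model g f gradf L (u k) (u k.+1) <= prox_model g f gradf L (u k) v)%E).

End L2.

Section AssB.
Context {R : realType}.
Variable g : R -> \bar R.

(* real part of g (meaningful where g is finite) and its derivatives *)
Definition gR (u : R) : R := fine (g u).
Definition g2 : R -> R := derive1 (derive1 gR).

Definition twice_diff_on0 (e : R) : Prop :=
  0 < e /\ forall u, 0 < u < e ->
    g u \is a fin_num /\ derivable gR u 1 /\ derivable (derive1 gR) u 1.

Definition limsup_g2 : \bar R := limf_esup (fun u => (g2 u)%:E) (0^'+).

Definition B1 : Prop :=
  lower_semicontinuous g /\ (forall u, g (- u) = g u) /\ g 0 = 0%E.
Definition B2 : Prop := exists u, u != 0 /\ (g u < +oo)%E.
Definition B3a : Prop :=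
  (exists e, twice_diff_on0 e) /\ exists r : R, r < 0 /\ limsup_g2 = r%:E.
Definition B3b : Prop :=
  (exists e, twice_diff_on0 e) /\ g2 x @[x --> 0^'+] --> -oo.
Definition B3c : Prop := (limf_einf g (0^'+) > 0)%E.
Definition B4 : Prop := forall u, (0 <= g u)%E.

Definition assumptionB : Prop := B1 /\ B2 /\ (B3a \/ B3b \/ B3c) /\ B4.

Definition s0 : R :=
  if `[< B3b \/ B3c >] then 0 else - 1 / fine limsup_g2.

Definition GL (L : R) (z : R) : set R :=
  [set u | forall v, ((- (z * u) + L / 2 * (u - u) ^+ 2)%:E + g u
                       <= (- (z * v) + L / 2 * (v - u) ^+ 2)%:E + g v)%E].
Definition Gplus L z : set R := GL L z `&` [set u | 0 < u].
Definition Gminus L z : set R := GL L z `&` [set u | u < 0].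
Definition Gzero L z : set R := GL L z `&` [set 0].

End AssB.

Definition conv_hull {R : realType} (A : set R) : set R :=
  [set y | forall C : set (convex_lmodType R^o),
      convex_set C -> A `<=` C -> C y].

(* conv^oo F (x) = outer limit of conv (U_{|x'-x| < 1/(k+1)} F x') *)
Definition conv_inf {R : realType} (F : R -> set R) (x : R) : set R :=
  [set y | exists (phi : nat -> nat) (yj : nat -> R),
      (forall j, (phi j < phi j.+1)%N) /\
      (forall j, conv_hull (\bigcup_(x' in [set x' | `|x' - x| < (phi j).+1%:R^-1]) F x') (yj j)) /\
      yj j @[j --> \oo] --> y].

(* Main.v *)
Require Import Defs.
From HB Require Import structures.
From mathcomp Require Import all_boot all_order all_algebra.
From mathcomp Require Import all_classical all_reals all_analysis.
From mathcomp Require Import interval_inference measurable_realfun ring lra.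
Set Implicit Arguments.
Unset Strict Implicit.
Unset Printing Implicit Defensive.
Import Order.TTheory GRing.Theory Num.Theory Num.Def.
Import numFieldNormedType.Exports.
Local Open Scope classical_set_scope.
Local Open Scope ring_scope.

(**
  A proximal step is a pointwise minimization, and completing the square puts
  it in the form [u_(k+1)(x) \in GL (z_k(x))] for a.e. [x], where
  [z_k = - gradf u_k - L (u_(k+1) - u_k)]. Since [Lf < L], the objective
  decreases by a multiple of [||u_(k+1) - u_k||^2], so these squares are summable
  and [u_(k+1)(x) - u_k(x) --> 0] a.e.; hence [z_(k_n)(x) --> - gradf ustar x].
  Since [s0 < 1/L], nonzero elements of [GL z] are bounded away from [0]
  uniformly in [z], so for a.e. [x] the sign of [u_k(x)] is eventually constant:
  zero, positive or negative, which gives the three pieces of the conclusion.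
  Finally, testing weak convergence with indicator functions shows
  [liminf u_(k_n)(x) <= ustar x <= limsup u_(k_n)(x)] a.e., and on the line this
  is all that membership in the outer limit of convex hulls needs.
*)

(** * Convex hulls on the line and the jump of the proximal map *)

Lemma sub_conv_hull (R : realType) (A : set R) : A `<=` conv_hull A.
Proof. by move=> a Aa C _; exact. Qed.

Lemma conv_hull_between (R : realType) (A : set R) (a b y : R) :
  A a -> A b -> a <= y <= b -> conv_hull A y.
Proof.
move=> Aa Ab /andP[ay yb] C cC AC.
have [ab|ab] := eqVneq a b.
  have -> : y = a by apply/eqP; rewrite eq_le ay {1}ab yb.
  exact: AC.
have {}ab : a < b by rewrite lt_neqAle ab (le_trans ay yb).
have t0 : 0 <= (b - y) / (b - a) by rewrite divr_ge0 ?subr_ge0 // ltW.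
have t1 : (b - y) / (b - a) <= 1 by rewrite ler_pdivrMr ?subr_gt0 // mul1r lerB.
have := cC a b (Itv01 t0 t1) (mem_set (AC _ Aa)) (mem_set (AC _ Ab)).
move/set_mem; congr (C _).
rewrite /conv /= /unstable.onem /GRing.scale /=.
have ba : b - a != 0 by rewrite subr_eq0 gt_eqF.
by field.
Qed.

(** Take one value of [F] below [y + e] and one above [y - e]. Either they enclose [y], which then
    lies in the hull, or one of them is itself within [e] of [y]. With [e = 1/(m+1)] the hulls
    contain points tending to [y], so the whole sequence serves as the subsequence. *)
Lemma conv_inf_squeeze (R : realType) (F : R -> set R) (x y : R) :
  (forall (m : nat) (e : R), 0 < e ->
     (exists x' a, [/\ `|x' - x| < m.+1%:R^-1, F x' a & a < y + e]) /\
     (exists x' b, [/\ `|x' - x| < m.+1%:R^-1, F x' b & y - e < b])) ->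
  conv_inf F x y.
Proof.
move=> H.
pose A m := \bigcup_(x' in [set x' | `|x' - x| < m.+1%:R^-1]) F x'.
have ex (m : nat) : exists w, conv_hull (A m) w /\ `|y - w| < m.+1%:R^-1.
  have e0 : 0 < m.+1%:R^-1 :> R by [].
  have [[x1 [a [xa Fa la]]] [x2 [b [xb Fb lb]]]] := H m _ e0.
  have Aa : A m a by exists x1.
  have Ab : A m b by exists x2.
  move: (m.+1%:R^-1) e0 la lb => e e0 la lb.
  have [ya|ay] := leP y a.
    exists a; split; first exact: sub_conv_hull.
    by rewrite ltr_distlC; apply/andP; split; lra.
  have [yb|by_] := leP y b.
    exists y; split; last by rewrite subrr normr0.
    by apply: (@conv_hull_between _ _ a b) => //; rewrite yb ltW.
  exists b; split; first exact: sub_conv_hull.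
  by rewrite ltr_distlC; apply/andP; split; lra.
pose w m := projT1 (cid (ex m)).
have wP m : conv_hull (A m) (w m) /\ `|y - w m| < m.+1%:R^-1.
  by rewrite /w; case: (cid (ex m)).
exists id, w; split=> [//|]; split=> [j|]; first by have [] := wP j.
apply/cvgrPdist_lt => e e0.
near=> m.
apply: lt_trans (proj2 (wP m)) _.
near: m; exact: near_infty_natSinv_lt (PosNum e0).
Unshelve. all: by end_near. Qed.

Lemma near_at_right0_itv (R : realType) (P : R -> Prop) :
  (\forall v \near 0^'+, P v) -> exists2 e : R, 0 < e & forall v, 0 < v < e -> P v.
Proof.
move=> /nbhs_ballP[e /= e0 He]; exists e => // v /andP[v0 ve].
by apply: He => //; rewrite /ball /= sub0r normrN gtr0_norm.
Qed.

Section prox_map.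
Context {R : realType}.
Variables (g : R -> \bar R) (L : R).
Hypothesis gsym : forall v, g (- v) = g v.
Hypothesis g0 : g 0 = 0%E.
Hypothesis gge0 : forall v, (0 <= g v)%E.

(** Comparison with [0], where [g] vanishes, forces [g v] to be finite, and competitors with
    infinite [g] are harmless. Membership thus becomes a family of real inequalities, open to linear
    arithmetic. *)
Lemma GLP z v : GL g L z v <-> g v \is a fin_num /\
  forall w, g w \is a fin_num ->
    gR g v - z * v <= gR g w - z * w + L / 2 * (w - v) ^+ 2.
Proof.
split=> [H|[fv H] w].
  have fv : g v \is a fin_num.
    rewrite ge0_fin_numE //; have := H 0; rewrite g0 adde0.
    by case: (g v) => // r; rewrite ltry.
  split=> // w fw; have := H w.
  rewrite -(fineK fv) -(fineK fw) -!EFinD lee_fin /gR.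
  by rewrite subrr expr0n /=; lra.
have [fw|] := boolP (g w \is a fin_num).
  have := H w fw; rewrite -(fineK fv) -(fineK fw) -!EFinD lee_fin /gR.
  by rewrite subrr expr0n /=; lra.
rewrite ge0_fin_numE // -leNgt leye_eq => /eqP ->.
by rewrite addey // leey.
Qed.

Lemma gRN v : gR g (- v) = gR g v. Proof. by rewrite /gR gsym. Qed.

Lemma GL_opp z v : GL g L z v -> GL g L (- z) (- v).
Proof.
move=> /GLP[fv H]; apply/GLP; rewrite gsym; split=> // w fw.
have := H (- w); rewrite gsym !gRN => /(_ fw).
by rewrite (_ : (- w - v) ^+ 2 = (w - - v) ^+ 2); [lra | ring].
Qed.

(** For each fixed [v], optimality of [0] reads [z v <= g v + L/2 v^2], a closed condition on
    [z]. *)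
Lemma GL0_closed (z : nat -> R) z0 :
  z n @[n --> \oo] --> z0 -> (\forall n \near \oo, GL g L (z n) 0) ->
  GL g L z0 0.
Proof.
move=> zz0 H; apply/GLP; rewrite g0; split=> // v fv.
rewrite /gR g0 /= mulr0 !subr0 -(@lerD2r _ (z0 * v)) add0r.
have -> : fine (g v) - z0 * v + L / 2 * v ^+ 2 + z0 * v =
  fine (g v) + L / 2 * v ^+ 2 by ring.
apply: (@cvgr_to_le _ \oo _ _ (fun n => z n * v)).
  exact: cvgMr_tmp.
apply: filterS H => n /GLP[_ /(_ v fv)]; rewrite /gR g0 /= mulr0 !subr0; lra.
Qed.

(** Near [0] a positive [v] costs at least some [c > 0], while [0] is free. A small [v] could offset
    this only with a large [z], but then the point [w] of the domain would do better. *)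
Lemma GL_jump_B3c : 0 < L -> B2 g -> B3c g ->
  exists2 t, 0 < t & forall z v, GL g L z v -> 0 < v -> t <= v.
Proof.
move=> L0 [w [w0 gw]] hc.
wlog {w0} w0 : w gw / 0 < w => [hw|].
  move: w0; rewrite neq_lt => /orP[] h; last exact: (hw w).
  by apply: (hw (- w)); rewrite ?gsym // oppr_gt0.
have fw : g w \is a fin_num by rewrite ge0_fin_numE.
have [c c0 [e e0 Hc]] : exists2 c : R, 0 < c &
    exists2 e : R, 0 < e & forall v, 0 < v < e -> (c%:E <= g v)%E.
  move: hc; rewrite /B3c limf_einfE => /ereal_sup_gt[_ [V V0 <-]] hV.
  have [e e0 He] := near_at_right0_itv V0.
  have lbV v : 0 < v < e -> (ereal_inf (g @` V) <= g v)%E.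
    by move=> /He Vv; apply: ereal_inf_lbound; exists v.
  case: (ereal_inf (g @` V)) hV lbV => [r|_|//].
    by rewrite lte_fin => r0 lbV; exists r => //; exists e.
  by move=> lbV; exists 1 => //; exists e => // v /lbV; apply: le_trans; rewrite leey.
(* comparing [v] with [w] bounds [z] by [K]; comparing it with [0] then gives
   [c <= K v + L / 2 v^2] *)
pose K := (L * w ^+ 2 + 2 * gR g w) / w.
have gw0 : 0 <= gR g w by rewrite /gR fine_ge0.
have Kw : K * w = L * w ^+ 2 + 2 * gR g w by rewrite /K divfK // gt_eqF.
have K0 : 0 <= K by rewrite divr_ge0 ?addr_ge0 ?mulr_ge0 ?sqr_ge0 // ltW.
have D0 : 0 < K + L * w by rewrite ltr_wpDl // mulr_gt0.
(* Below [e] one has [g v >= c]; below [w / 2] the gap [w - v] is at least [w / 2], which bounds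
   [z], and [L/2 v^2 <= L w v]; the last bound then contradicts [c <= (K + L w) v]. *)
exists (minr (minr e (w / 2)) (c / (K + L * w))).
  by rewrite !lt_min e0 !divr_gt0.
move=> z v /GLP[fv H] v0; rewrite leNgt !lt_min -andbA; apply/negP => /and3P[ve vw vc].
have cv : c <= gR g v.
  by rewrite -lee_fin /gR fineK //; apply: Hc; rewrite v0.
have H0 : c <= z * v + L / 2 * v ^+ 2.
  have := H 0; rewrite {2}/gR g0 /= mulr0 !sub0r sqrrN => /(_ isT); lra.
have Hw := H w fw.
move: vc; rewrite ltr_pdivlMr // => vc.
have vv : L / 2 * v ^+ 2 <= L * w * v.
  rewrite expr2 !mulrA ler_pM2r // -!mulrA ler_pM2l //; lra.
have zK : z <= K.
  have [z0|z0] := leP z 0; first exact: le_trans z0 K0.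
  have zw : z * (w / 2) <= z * (w - v) by rewrite ler_pM2l //; lra.
  have wv : L / 2 * (w - v) ^+ 2 <= L / 2 * w ^+ 2.
    by rewrite ler_pM2l ?divr_gt0 // ler_sqr ?nnegrE; lra.
  rewrite -(@ler_pM2r _ w) // Kw; lra.
have : z * v <= K * v by rewrite ler_pM2r.
lra.
Qed.

Lemma GL_jump_g2 e : twice_diff_on0 g e -> (\forall v \near 0^'+, g2 g v < - L) ->
  exists2 t, 0 < t & forall z v, GL g L z v -> 0 < v -> t <= v.
Proof.
move=> [e0 De] /near_at_right0_itv[e1 e10 H].
exists (minr e e1); first by rewrite lt_min e0.
move=> z v /GLP[fv Hv] v0; rewrite leNgt lt_min; apply/negP => /andP[ve ve1].
(* [phi'' = g'' + L < 0] near [0], so [phi] has no interior minimizer there *)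
pose phi x := gR g x - z * x + L / 2 * (x - v) ^+ 2.
pose dphi x := derive1 (gR g) x - z + L * (x - v).
have dgR x : 0 < x < e -> is_derive x 1 (gR g) (derive1 (gR g) x).
  by move=> /De[_ [Dx _]]; split => //; rewrite derive1E.
have d2gR x : 0 < x < e -> is_derive x 1 (derive1 (gR g)) (g2 g x).
  by move=> /De[_ [_ Dx]]; split => //; rewrite /g2 derive1E.
have Dphi x : 0 < x < e -> is_derive x 1 phi (dphi x).
  move=> /dgR Dx; rewrite /phi /dphi.
  apply: is_derive_eq; rewrite /GRing.scale /=; lra.
have Ddphi x : 0 < x < e -> is_derive x 1 dphi (g2 g x + L).
  move=> /d2gR Dx; rewrite /dphi.
  apply: is_derive_eq; rewrite /GRing.scale /=; lra.
have MVT0 (F dF : R -> R) a b : 0 < a -> a < b -> b < e ->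
    (forall x, 0 < x < e -> is_derive x 1 F (dF x)) ->
    exists2 c, a < c < b & F b - F a = dF c * (b - a).
  move=> a0 ab be DF.
  have [||c] := @MVT R F dF a b ab.
  - move=> x; rewrite in_itv /= => /andP[ax xb]; apply: DF.
    by rewrite (lt_trans a0 ax) (lt_trans xb be).
  - apply: derivable_within_continuous => x; rewrite in_itv /= => /andP[ax xb].
    have [] // := DF x; by rewrite (lt_le_trans a0 ax) (le_lt_trans xb be).
  - by rewrite in_itv /=; exists c.
have phimin x : 0 < x < e -> phi v <= phi x.
  move=> /De[/Hv]; rewrite /phi subrr expr0n /= mulr0; lra.
(* Half the distance from [v] to the nearer end of the interval where the derivative bounds hold, so
   that [v - h] and [v + h] stay inside it. *)
pose h := minr v (minr e e1 - v) / 2.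
have h0 : 0 < h by rewrite divr_gt0 // lt_min v0 subr_gt0 lt_min ve.
have hv : 2 * h <= v by rewrite /h mulrCA divff // mulr1 ge_min lexx.
have he : 2 * h <= minr e e1 - v by rewrite /h mulrCA divff // mulr1 ge_min lexx orbT.
have hee : 2 * h <= e - v by apply: le_trans he _; rewrite lerD2r ge_min lexx.
have hee1 : 2 * h <= e1 - v by apply: le_trans he _; rewrite lerD2r ge_min lexx orbT.
(* Minimality at [v] gives a slope [<= 0] at some [a < v] and a slope [>= 0] at some [b > v]; a
   third mean value between [a] and [b] contradicts the negative second derivative. *)
have [|||a /andP[a1 a2] Ea] := MVT0 phi dphi (v - h) v _ _ _ Dphi; [lra..|].
have [|||b /andP[b1 b2] Eb] := MVT0 phi dphi v (v + h) _ _ _ Dphi; [lra..|].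
have pa : dphi a <= 0.
  rewrite -(@ler_pM2r _ (v - (v - h))); last lra.
  rewrite -Ea mul0r subr_le0 phimin //; apply/andP; split; lra.
have pb : 0 <= dphi b.
  rewrite -(@ler_pM2r _ (v + h - v)); last lra.
  rewrite -Eb mul0r subr_ge0 phimin //; apply/andP; split; lra.
have [|||c /andP[c1 c2] Ec] := MVT0 dphi _ a b _ _ _ Ddphi; [lra..|].
have gc : g2 g c < - L by apply: H; apply/andP; split; lra.
have : (g2 g c + L) * (b - a) < 0 by rewrite nmulr_rlt0; lra.
lra.
Qed.

(** Symmetry reduces to positive elements. Apart from the case [B3c], the task is to bring [g2]
    below [-L] near [0]: immediate under [B3b], and under [B3a] the meaning of [s0 < 1/L]. *)
Lemma GL_jump : 0 < L -> assumptionB g -> s0 g < L^-1 ->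
  exists2 t, 0 < t & forall z v, GL g L z v -> v != 0 -> t <= `|v|.
Proof.
move=> L0 [_ [b2 [b3 _]]] hs.
suff [t t0 Ht] : exists2 t, 0 < t & forall z v, GL g L z v -> 0 < v -> t <= v.
  exists t => // z v Hv; rewrite neq_lt => /orP[v0|v0].
    by rewrite ltr0_norm // (Ht (- z)) ?oppr_gt0 //; exact: GL_opp.
  by rewrite gtr0_norm // (Ht z).
have [c|nc] := pselect (B3c g); first exact: GL_jump_B3c.
have [[[e De] b]|nb] := pselect (B3b g).
  by apply: (@GL_jump_g2 e) => //; move/cvgrNyPlt: b; exact.
have [[e De] [r [r0 Er]]] : B3a g by case: b3 => // -[].
apply: (@GL_jump_g2 e) => //.
(* Both [B3b] and [B3c] fail here, so [s0] is [-1/r] with [r < 0], and the hypothesis says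
   [r < -L]. *)
move: hs; rewrite /s0 Er /= asboolF; last by case.
move=> hs; have rL : r < - L.
  move: hs; rewrite mulN1r -invrN ltf_pV2 ?posrE ?oppr_gt0 //; lra.
move: Er => /eqP; rewrite eq_le => /andP[Er _].
have : (limsup_g2 g < (- L)%:E)%E by apply: le_lt_trans Er _; rewrite lte_fin.
move=> /ereal_inf_lt[_ [V V0 <-]] hV; apply: filterS V0 => v Vv.
rewrite -lte_fin; apply: le_lt_trans hV; apply: ereal_sup_ubound.
by exists v.
Qed.

End prox_map.

(** * Square-integrable functions and weak limits *)

Section L2_theory.
Context {d : measure_display} {T : measurableType d} {R : realType}.
Variables (mu : {measure set T -> \bar R}) (Om : set T).
Hypotheses (mOm : measurable Om) (finOm : (mu Om < +oo)%E).
Local Notation inL2 := (inL2 mu Om).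
Local Notation L2norm := (L2norm mu Om).
Local Notation L2inner := (L2inner mu Om).
Implicit Types u v w h : T -> R.

Lemma inL2_integrable_sqr u : inL2 u ->
  mu.-integrable Om (EFin \o (fun x => u x ^+ 2)).
Proof.
move=> [mu_ iu]; apply/integrableP; split.
  by apply/measurable_EFinP; exact: measurable_funX.
by under eq_integral do rewrite /= ger0_norm ?sqr_ge0 //.
Qed.

Lemma integrable_norm_le (f h : T -> R) : measurable_fun Om f ->
  (forall x, Om x -> `|f x| <= h x) -> mu.-integrable Om (EFin \o h) ->
  mu.-integrable Om (EFin \o f).
Proof.
move=> mf fh; apply: le_integrable => //; first exact/measurable_EFinP.
by move=> x Ox /=; rewrite lee_fin (le_trans (fh x Ox)) // ler_norm.
Qed.

Lemma integrable_addR (f h : T -> R) : mu.-integrable Om (EFin \o f) ->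
  mu.-integrable Om (EFin \o h) -> mu.-integrable Om (EFin \o (f \+ h)).
Proof. by move=> iF ih; exact: (integrableD mOm iF ih). Qed.

Lemma integrable_subR (f h : T -> R) : mu.-integrable Om (EFin \o f) ->
  mu.-integrable Om (EFin \o h) -> mu.-integrable Om (EFin \o (f \- h)).
Proof. by move=> iF ih; exact: (integrableB mOm iF ih). Qed.

Lemma integrable_scaleR c (f : T -> R) : mu.-integrable Om (EFin \o f) ->
  mu.-integrable Om (EFin \o (fun x => c * f x)).
Proof. by move=> iF; exact: (integrableZl mOm c iF). Qed.

Lemma integrable_cstR (c : R) : mu.-integrable Om (EFin \o cst c).
Proof.
apply/integrableP; split; first exact/measurable_EFinP.
by rewrite /= integral_cst //; apply: lte_mul_pinfty.
Qed.

Lemma integrable_inL2 u : measurable_fun Om u ->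
  mu.-integrable Om (EFin \o (fun x => u x ^+ 2)) -> inL2 u.
Proof.
move=> mU /integrableP[_ iu]; split=> //; apply: le_lt_trans iu.
by under [X in (_ <= X)%E]eq_integral do rewrite /= ger0_norm ?sqr_ge0 //.
Qed.

Lemma inL2_integrable_mul u v : inL2 u -> inL2 v ->
  mu.-integrable Om (EFin \o (u \* v)).
Proof.
move=> Lu Lv.
apply: (@integrable_norm_le _ (fun x => u x ^+ 2 + v x ^+ 2)).
- by apply: measurable_funM; [exact: Lu.1 | exact: Lv.1].
- move=> x _ /=; rewrite ler_norml; apply/andP; split.
    have := sqr_ge0 (u x + v x); have := sqr_ge0 (u x); have := sqr_ge0 (v x); nra.
  have := sqr_ge0 (u x - v x); have := sqr_ge0 (u x); have := sqr_ge0 (v x); nra.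
- by apply: integrable_addR; exact: inL2_integrable_sqr.
Qed.

Lemma inL2_cst c : inL2 (cst c).
Proof. by apply: integrable_inL2 => //; exact: (integrable_cstR (c ^+ 2)). Qed.

Lemma inL2D u v : inL2 u -> inL2 v -> inL2 (u \+ v).
Proof.
move=> Lu Lv; have mS : measurable_fun Om (u \+ v).
  by apply: measurable_funD; [exact: Lu.1 | exact: Lv.1].
apply: integrable_inL2 => //.
apply: (@integrable_norm_le _ (fun x => 2 * u x ^+ 2 + 2 * v x ^+ 2)).
- exact: measurable_funX.
- move=> x _ /=; rewrite ger0_norm ?sqr_ge0 //.
  have := sqr_ge0 (u x - v x); nra.
- by apply: integrable_addR; apply: integrable_scaleR; exact: inL2_integrable_sqr.
Qed.

Lemma inL2Z c u : inL2 u -> inL2 (fun x => c * u x).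
Proof.
move=> Lu; apply: integrable_inL2.
  by apply: measurable_funM => //; exact: Lu.1.
have := integrable_scaleR (c ^+ 2) (inL2_integrable_sqr Lu).
by apply: eq_integrable => // x _ /=; rewrite exprMn.
Qed.

Lemma inL2B u v : inL2 u -> inL2 v -> inL2 (u \- v).
Proof.
move=> Lu Lv; have := inL2D Lu (inL2Z (-1) Lv).
by congr (Defs.inL2 _ _ _); apply/funext => x /=; rewrite mulN1r.
Qed.

Lemma inL2_if (A : T -> bool) u v : measurable_fun Om A -> inL2 u -> inL2 v ->
  inL2 (fun x => if A x then u x else v x).
Proof.
move=> mA Lu Lv; have mw : measurable_fun Om (fun x => if A x then u x else v x).
  apply: measurable_fun_if => //.
    by apply: measurable_funS Lu.1 => //; exact: subIsetl.
  by apply: measurable_funS Lv.1 => //; exact: subIsetl.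
apply: integrable_inL2 => //.
apply: (@integrable_norm_le _ (fun x => u x ^+ 2 + v x ^+ 2)).
- exact: measurable_funX.
- move=> x _ /=; rewrite ger0_norm ?sqr_ge0 //.
  by case: ifP => _; rewrite ?lerDl ?lerDr sqr_ge0.
- by apply: integrable_addR; exact: inL2_integrable_sqr.
Qed.

Lemma L2norm_ge0 u : 0 <= L2norm u. Proof. exact: sqrtr_ge0. Qed.

Lemma L2norm_sqr u : L2norm u ^+ 2 = \int[mu]_(x in Om) (u x ^+ 2).
Proof. by rewrite sqr_sqrtr //; apply: Rintegral_ge0 => x _; exact: sqr_ge0. Qed.

Lemma L2innerE u v : L2inner u v = \int[mu]_(x in Om) (u x * v x).
Proof. by []. Qed.

Lemma L2normZ c u : inL2 u -> L2norm (fun x => c * u x) = `|c| * L2norm u.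
Proof.
move=> Lu; apply/eqP; rewrite -(@eqrXn2 _ 2) ?mulr_ge0 ?L2norm_ge0 //; apply/eqP.
rewrite exprMn !L2norm_sqr real_normK ?num_real //.
rewrite -RintegralZl //; last exact: inL2_integrable_sqr.
by apply: eq_Rintegral => x _; rewrite exprMn.
Qed.

(** The form of Cauchy-Schwarz suited to a Lipschitz bound, obtained by integrating a pointwise
    inequality. *)
Lemma L2inner_le K w h : 0 < K -> inL2 w -> inL2 h ->
  L2norm w <= K * L2norm h -> L2inner w h <= K * L2norm h ^+ 2.
Proof.
move=> K0 Lw Lh wh.
have iw := inL2_integrable_sqr Lw; have ih := inL2_integrable_sqr Lh.
(* AM-GM: [w h <= w^2 / (2 K) + K h^2 / 2] *)
have : L2inner w h <= (2 * K)^-1 * L2norm w ^+ 2 + K / 2 * L2norm h ^+ 2.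
  rewrite !L2norm_sqr -!RintegralZl // -RintegralD //; [|exact: integrable_scaleR..].
  apply: le_Rintegral => //; first exact: inL2_integrable_mul.
    by apply: integrable_addR; exact: integrable_scaleR.
  move=> x _; rewrite -subr_ge0.
  have -> : (2 * K)^-1 * w x ^+ 2 + K / 2 * h x ^+ 2 - w x * h x =
     (2 * K)^-1 * (w x - K * h x) ^+ 2.
    by field; rewrite gt_eqF.
  by rewrite mulr_ge0 ?sqr_ge0 // invr_ge0 mulr_ge0 // ltW.
move/le_trans; apply.
have : L2norm w ^+ 2 <= (K * L2norm h) ^+ 2.
  by rewrite ler_sqr ?nnegrE ?mulr_ge0 ?L2norm_ge0 // ltW.
rewrite -(@ler_pM2l _ (2 * K)^-1) ?invr_gt0 ?mulr_gt0 //.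
have -> : (2 * K)^-1 * (K * L2norm h) ^+ 2 = K / 2 * L2norm h ^+ 2.
  by field; rewrite gt_eqF.
lra.
Qed.

Lemma L2innerBl u v h : inL2 u -> inL2 v -> inL2 h ->
  L2inner (u \- v) h = L2inner u h - L2inner v h.
Proof.
move=> Lu Lv Lh; rewrite !L2innerE -RintegralB //; [|exact: inL2_integrable_mul..].
by apply: eq_Rintegral => x _; rewrite /= mulrBl.
Qed.

Lemma L2innerZr c u h : inL2 u -> inL2 h ->
  L2inner u (fun x => c * h x) = c * L2inner u h.
Proof.
move=> Lu Lh; rewrite !L2innerE -RintegralZl //; last exact: inL2_integrable_mul.
by apply: eq_Rintegral => x _; rewrite mulrCA.
Qed.

(** Nonnegativity allows sum and integral to be exchanged, so [S], the sum of the squares, is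
    integrable and hence finite a.e.; the terms of a convergent series tend to [0]. *)
Lemma ae_cvg0_of_summable (w : nat -> T -> R) C : (forall n, inL2 (w n)) ->
  (forall n, \sum_(k < n) L2norm (w k) ^+ 2 <= C) ->
  {ae mu, forall x, Om x -> w n x @[n --> \oo] --> 0}.
Proof.
move=> Lw HC.
pose S x : \bar R := (\sum_(0 <= k <oo) (w k x ^+ 2)%:E)%E.
have mw k : measurable_fun Om (fun x => (w k x ^+ 2)%:E).
  by apply/measurable_EFinP; apply: measurable_funX; exact: (Lw k).1.
have S0 x : (0 <= S x)%E by apply: nneseries_ge0 => k _ _; rewrite lee_fin sqr_ge0.
have iS : mu.-integrable Om S.
  apply/integrableP; split.
    apply: ge0_emeasurable_sum => // k x _ _; by rewrite lee_fin sqr_ge0.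
  under eq_integral do rewrite gee0_abs //.
  rewrite integral_nneseries //; last by move=> k x _; rewrite lee_fin sqr_ge0.
  apply: (@le_lt_trans _ _ C%:E); last exact: ltry.
  apply: lime_le.
    apply: is_cvg_nneseries => k _ _.
    by apply: integral_ge0 => x _; rewrite lee_fin sqr_ge0.
  apply: nearW => n.
  apply: le_trans (_ : (\sum_(k < n) L2norm (w k) ^+ 2)%:E <= _)%E; last first.
    by rewrite lee_fin.
  rewrite big_mkord -sumEFin; apply: lee_sum => k _.
  rewrite L2norm_sqr /Rintegral fineK //.
  by apply: integrable_fin_num => //; exact: inL2_integrable_sqr.
apply: filterS (integrable_ae mOm iS) => x Sx /Sx {}Sx.
have sw : cvgn (series (fun k => w k x ^+ 2)).
  apply: nondecreasing_is_cvgn.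
    by apply: nondecreasing_series => k _ _; exact: sqr_ge0.
  exists (fine (S x)) => _ [n _ <-].
  rewrite -lee_fin fineK // /series /= -sumEFin.
  by apply: nneseries_lim_ge => k _ _; rewrite lee_fin sqr_ge0.
have /cvgrPdist_lt s0 := cvg_series_cvg_0 sw.
apply/cvgrPdist_lt => e e0.
have e20 : 0 < e ^+ 2 by rewrite exprn_gt0.
apply: filterS (s0 _ e20) => n /=.
rewrite !sub0r !normrN ger0_norm ?sqr_ge0 // -(real_normK (num_real (w n x))).
by rewrite ltr_sqr ?nnegrE // ltW.
Qed.

Lemma L2weak_cvgZ c (w : nat -> T -> R) u : (forall n, inL2 (w n)) -> inL2 u ->
  L2weak_cvg mu Om w u ->
  L2weak_cvg mu Om (fun n x => c * w n x) (fun x => c * u x).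
Proof.
move=> Lw Lu wu v Lv.
have E h : L2inner (fun x => c * h x) v = L2inner h (fun x => c * v x).
  by apply: eq_Rintegral => x _; rewrite mulrAC mulrC mulrA.
rewrite E; under eq_fun do rewrite E.
by apply: wu; exact: inL2Z.
Qed.

(** If [w n] exceeded [u] by a fixed amount on a set of positive measure for all large [n], the
    indicator of that set, square-integrable since [Om] has finite measure, would contradict weak
    convergence. *)
Lemma weak_cvg_frequently_lt (w : nat -> T -> R) u :
  (forall n, inL2 (w n)) -> inL2 u -> L2weak_cvg mu Om w u ->
  {ae mu, forall x, Om x -> forall (e : R) (N : nat), 0 < e ->
     exists2 n, (N <= n)%N & w n x < u x + e}.
Proof.
move=> Lw Lu wu.
(* The points where the claim fails lie in the countable union of the [B N j]: there [w n] stays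
   above [u] by [1/(j+1)] from index [N] on. *)
pose B N j := Om `&` \bigcap_(n in [set n | (N <= n)%N])
  (Om `&` [set x | u x + j.+1%:R^-1 <= w n x]).
have mB N j : measurable (B N j).
  apply: measurableI => //; apply: bigcap_measurable => [|n _]; first by exists N => /=.
  have mf : measurable_fun Om (fun x => u x + j.+1%:R^-1 <= w n x).
    apply: measurable_fun_ler; last exact: (Lw n).1.
    by apply: measurable_funD => //; exact: Lu.1.
  exact: (mf mOm [set true] I).
have LB N j : inL2 \1_(B N j).
  apply: integrable_inL2; first exact: measurable_indic.
  apply: (@integrable_norm_le _ (cst 1)); last exact: integrable_cstR.
    by apply: measurable_funX; exact: measurable_indic.
  move=> x _; rewrite indicE ger0_norm ?sqr_ge0 //.
  by case: (x \in B N j); rewrite /= ?expr1n // expr0n.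
have iB N j : mu.-integrable Om (EFin \o \1_(B N j)).
  apply: (@integrable_norm_le _ (cst 1)); last exact: integrable_cstR.
    exact: measurable_indic.
  by move=> x _; rewrite indicE ger0_norm // lern1 leq_b1.
have B0 N j : mu (B N j) = 0%E.
  have e0 : 0 < j.+1%:R^-1 :> R by [].
  have le1 n : (N <= n)%N -> L2inner u \1_(B N j) +
      j.+1%:R^-1 * \int[mu]_(x in Om) \1_(B N j) x <= L2inner (w n) \1_(B N j).
    move=> Nn; rewrite !L2innerE -RintegralZl // -RintegralD //;
      [|exact: inL2_integrable_mul|exact: integrable_scaleR].
    apply: le_Rintegral => //.
    - apply: integrable_addR; last exact: integrable_scaleR.
      exact: inL2_integrable_mul.
    - exact: inL2_integrable_mul.
    - move=> x Ox; rewrite -mulrDl indicE.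
      have [|_] := boolP (x \in B N j); last by rewrite !mulr0.
      by rewrite inE => -[_ /(_ n Nn) [_ /=]]; rewrite !mulr1.
  have : L2inner u \1_(B N j) + j.+1%:R^-1 * \int[mu]_(x in Om) \1_(B N j) x
      <= L2inner u \1_(B N j).
    apply: (cvgr_to_ge (wu _ (LB N j))).
    by exists N => // n /= Nn; exact: le1.
  rewrite gerDl pmulr_rle0 // /Rintegral integral_indic // => le0.
  have BO : B N j `&` Om = B N j by rewrite setIidl //; exact: subIsetl.
  rewrite BO in le0.
  have fB : mu (B N j) \is a fin_num.
    rewrite ge0_fin_numE //; apply: le_lt_trans finOm.
    by apply: le_measure; rewrite ?inE //; exact: subIsetl.
  rewrite -(fineK fB); congr EFin; apply/eqP; rewrite eq_le le0 /=.
  exact: fine_ge0.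
have : {ae mu, forall x (N j : nat), ~ B N j x}.
  apply: ae_foralln => N; apply: ae_foralln => j.
  exists (B N j); split=> // x /=; exact: contrapT.
apply: filterS => x nB Ox e N e0.
have [j je] : exists j : nat, j.+1%:R^-1 < e.
  have [j _ Hj] := near_infty_natSinv_lt (PosNum e0).
  by exists j; exact: (Hj j (leqnn j)).
apply: contrapT => H; apply: (nB N j); split=> // n /= Nn; split => //=.
rewrite leNgt; apply/negP => h; apply: H; exists n => //.
by apply: lt_trans h _; rewrite ltrD2l.
Qed.

Lemma weak_cvg_frequently_gt (w : nat -> T -> R) u :
  (forall n, inL2 (w n)) -> inL2 u -> L2weak_cvg mu Om w u ->
  {ae mu, forall x, Om x -> forall (e : R) (N : nat), 0 < e ->
     exists2 n, (N <= n)%N & u x - e < w n x}.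
Proof.
move=> Lw Lu wu.
have := weak_cvg_frequently_lt (fun n => inL2Z (-1) (Lw n)) (inL2Z (-1) Lu)
  (L2weak_cvgZ Lw Lu wu).
apply: filterS => x H Ox e N e0; have [n Nn h] := H Ox e N e0.
by exists n => //; lra.
Qed.

End L2_theory.

(** * Descent lemma for a functional with Lipschitz gradient *)

Section descent.
Context {d : measure_display} {T : measurableType d} {R : realType}.
Variables (mu : {measure set T -> \bar R}) (Om : set T).
Hypotheses (mOm : measurable Om) (finOm : (mu Om < +oo)%E).
Local Notation inL2 := (inL2 mu Om).
Local Notation L2norm := (L2norm mu Om).
Local Notation L2inner := (L2inner mu Om).
Variables (f : (T -> R) -> R) (gradf : (T -> R) -> (T -> R)) (Lf : R).
Hypothesis hA : assumptionA mu Om f gradf Lf.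

Lemma is_derive_along_line u h (t : R) : inL2 u -> inL2 h ->
  is_derive t 1 (fun s : R => f (u \+ (fun x => s * h x)))
    (L2inner (gradf (u \+ (fun x => t * h x))) h).
Proof.
move=> Lu Lh; have [_ [_ [hD _]]] := hA.
set l := L2inner _ _; set F := (F in is_derive _ _ F _).
have Lt : inL2 (u \+ (fun x => t * h x)) by apply: inL2D => //; exact: inL2Z.
have [Lg Hd] := hD _ Lt.
suff cF : s^-1 *: ((F \o shift t) (s *: 1) - F t) @[s --> 0^'] --> l.
  by apply: DeriveDef; [apply/cvg_ex; exists l | exact: cvg_lim].
apply/cvgrPdist_le => e e0.
(* The added [1] keeps the divisor positive when [h] has norm zero. *)
have n0 : 0 < L2norm h + 1 by rewrite ltr_wpDl // L2norm_ge0.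
have [dl dl0 Hdl] := Hd _ (divr_gt0 e0 n0).
near=> s.
have s0 : s != 0 by near: s; exact: nbhs_dnbhs_neq.
have sd : `|s| * (L2norm h + 1) < dl.
  rewrite -ltr_pdivlMr //; near: s; apply: dnbhs0_lt; exact: divr_gt0.
have Ls : inL2 (fun x => s * h x) by exact: inL2Z.
have nsE : L2norm (fun x => s * h x) = `|s| * L2norm h by exact: L2normZ.
have := Hdl _ Ls; rewrite nsE => /(_ _).
have -> : (u \+ (fun x => t * h x)) \+ (fun x => s * h x) =
    u \+ (fun x => (s + t) * h x).
  by apply/funext => x /=; rewrite -addrA -mulrDl [t + s]addrC.
rewrite L2innerZr // -/l.
rewrite /= /GRing.scale /= mulr1 -/(F (s + t)) -/(F t) => H.
have {}H : `|F (s + t) - F t - s * l| <= e / (L2norm h + 1) * (`|s| * L2norm h).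
  apply: H; apply: le_lt_trans sd; rewrite ler_wpM2l // lerDl //.
have -> : l - s^-1 * (F (s + t) - F t) = - s^-1 * (F (s + t) - F t - s * l).
  by field.
rewrite normrM normrN normfV -ler_pdivlMl ?invr_gt0 ?normr_gt0 // invrK.
apply: le_trans H _; rewrite mulrCA ler_wpM2l // -mulrA ger_pMr //.
by rewrite mulrC ler_pdivrMr // mul1r lerDl.
Unshelve. all: by end_near. Qed.

(** The mean value theorem replaces integration along the segment: [G 1 - G 0] is the difference of
    the two sides, and the Lipschitz bound makes the derivative of [G] nonpositive on the open
    segment. A positive [M] covers the case [Lf = 0]. *)
Lemma descent_lemma (M : R) u v : 0 < M -> Lf <= M -> inL2 u -> inL2 v ->
  f v <= f u + L2inner (gradf u) (v \- u) + M / 2 * L2norm (v \- u) ^+ 2.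
Proof.
move=> M0 LM Lu Lv; have [_ [_ [hD [_ hL]]]] := hA.
pose h := v \- u; have Lh : inL2 h by exact: inL2B.
pose F (s : R) := f (u \+ (fun x => s * h x)).
pose G (s : R) := F s - s * L2inner (gradf u) h - M / 2 * s ^+ 2 * L2norm h ^+ 2.
pose dG (s : R) := L2inner (gradf (u \+ (fun x => s * h x))) h - L2inner (gradf u) h
  - M * s * L2norm h ^+ 2.
have DG (s : R) : is_derive s 1 G (dG s).
  have DF := is_derive_along_line s Lu Lh.
  rewrite /G /dG; apply: is_derive_eq; rewrite /GRing.scale /=; lra.
have [|c] := @MVT R G dG 0 1 ltr01 (fun x _ => DG x).
  by apply: derivable_within_continuous => x _; have [] := DG x.
rewrite in_itv /= => /andP[c0 c1] E.
have Lc : inL2 (u \+ (fun x => c * h x)) by apply: inL2D => //; exact: inL2Z.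
have dG0 : dG c <= 0.
  have [Lgc _] := hD _ Lc; have [Lgu _] := hD _ Lu.
  rewrite /dG -L2innerBl //.
  rewrite subr_le0; apply: L2inner_le => //.
  - exact: mulr_gt0.
  - exact: inL2B.
  - apply: le_trans (hL _ _ Lc Lu) _.
    have -> : u \+ (fun x => c * h x) \- u = fun x => c * h x.
      by apply/funext => x /=; rewrite addrAC subrr add0r.
    rewrite L2normZ // gtr0_norm // mulrA ler_wpM2r ?L2norm_ge0 //.
    by rewrite ler_pM2r.
have F0 : F 0 = f u.
  by rewrite /F; congr f; apply/funext => x /=; rewrite mul0r addr0.
have F1 : F 1 = f v.
  by rewrite /F; congr f; apply/funext => x /=; rewrite /h /= mul1r addrC subrK.
have : G 1 - G 0 <= 0 by rewrite E subr0 mulr1.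
by rewrite /G F0 F1 -/h !expr1n expr0n /=; lra.
Qed.

End descent.

(** * Pointwise form of the proximal step *)

(* [g] is only lower semicontinuous: a countable dense subset of its domain would
   not do, the values of [g] have to be approximated as well. *)
Lemma countable_graph_dense (R : realType) (g : R -> \bar R) : g 0 = 0%E ->
  exists c : nat -> R, (forall n, g (c n) \is a fin_num) /\
    forall w, g w \is a fin_num -> exists s : nat -> nat,
      c (s j) @[j --> \oo] --> w /\ gR g (c (s j)) @[j --> \oo] --> gR g w.
Proof.
move=> g0.
(* An index is a rational point of the plane with a radius; one point of the graph of [g] is picked
   in each box that meets it. Empty boxes and invalid codes get [0], where [g] is finite. *)
pose S (i : rat * rat * nat) w := [/\ g w \is a fin_num,
  `|w - ratr i.1.1| < i.2.+1%:R^-1 & `|gR g w - ratr i.1.2| < i.2.+1%:R^-1].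
have ex (i : rat * rat * nat) :
    exists w, g w \is a fin_num /\ ((exists w', S i w') -> S i w).
  have [[w Sw]|nS] := pselect (exists w', S i w'); last by exists 0; rewrite g0.
  by exists w; split=> //; case: Sw.
pose c n := if unpickle n is Some i then projT1 (cid (ex i)) else 0.
exists c; split=> [n|w fw].
  rewrite /c; case: unpickle => [i|]; last by rewrite g0.
  by case: (cid (ex i)) => w [].
(* One radius leads from [w] to the rational centre, the other from the centre to the chosen
   point. *)
have key (j : nat) : exists n, `|w - c n| < j.+1%:R^-1 + j.+1%:R^-1 /\
    `|gR g w - gR g (c n)| < j.+1%:R^-1 + j.+1%:R^-1.
  have e0 : 0 < j.+1%:R^-1 :> R by [].
  have rat_near (x : R) : exists q : rat, `|x - ratr q| < j.+1%:R^-1.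
    have [|q] := @rat_in_itvoo R (x - j.+1%:R^-1) (x + j.+1%:R^-1).
      by move: (j.+1%:R^-1) e0 => e e0; lra.
    by rewrite in_itv /= => h; exists q; rewrite ltr_distlC.
  have [q wq] := rat_near w; have [r wr] := rat_near (gR g w).
  exists (pickle (q, r, j)); rewrite /c pickleK.
  case: (cid _) => /= v [fv]; case; first by exists w; split.
  move=> /= _ vq vr; split.
    apply: le_lt_trans (ler_distD (ratr q) _ _) _.
    by apply: ltrD => //; rewrite distrC.
  apply: le_lt_trans (ler_distD (ratr r) _ _) _.
  by apply: ltrD => //; rewrite distrC.
pose s j := projT1 (cid (key j)).
have sP j : `|w - c (s j)| < j.+1%:R^-1 + j.+1%:R^-1 /\
    `|gR g w - gR g (c (s j))| < j.+1%:R^-1 + j.+1%:R^-1.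
  by rewrite /s; case: (cid (key j)).
have small e : 0 < e -> \forall j \near \oo, j.+1%:R^-1 + j.+1%:R^-1 < e :> R.
  move=> e0; have e20 : 0 < e / 2 by rewrite divr_gt0.
  have := near_infty_natSinv_lt (PosNum e20).
  by apply: filterS => j /= h; rewrite [e]splitr ltrD.
exists s; split; apply/cvgrPdist_lt => e /small; apply: filterS => j h.
  exact: lt_trans (sP j).1 h.
exact: lt_trans (sP j).2 h.
Qed.

Section prox_step.
Context {d : measure_display} {T : measurableType d} {R : realType}.
Variables (mu : {measure set T -> \bar R}) (Om : set T).
Hypotheses (mOm : measurable Om) (finOm : (mu Om < +oo)%E).
Local Notation inL2 := (inL2 mu Om).
Local Notation L2norm := (L2norm mu Om).
Local Notation L2inner := (L2inner mu Om).
Variables (g : R -> \bar R) (f : (T -> R) -> R).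
Variables (gradf : (T -> R) -> (T -> R)) (L : R).
Hypotheses (lscg : lower_semicontinuous g) (g0 : g 0 = 0%E).
Hypothesis gge0 : forall v, (0 <= g v)%E.
Variables (a : T -> R).
Hypotheses (La : inL2 a) (Lga : inL2 (gradf a)).

(** The integrand of the proximal model at [a], without the constant [f a] and with the real part of
    [g]. *)
Let Q x (c : R) := gradf a x * (c - a x) + L / 2 * (c - a x) ^+ 2 + gR g c.

Lemma measurable_comp_lsc (v : T -> R) : measurable_fun Om v ->
  measurable_fun Om (g \o v).
Proof. by apply: measurableT_comp; exact: lower_semicontinuous_measurable. Qed.

Lemma integrable_comp_lsc (v : T -> R) : measurable_fun Om v ->
  (\int[mu]_(x in Om) g (v x) < +oo)%E -> mu.-integrable Om (g \o v).
Proof.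
move=> mv iv; apply/integrableP; split; first exact: measurable_comp_lsc.
under eq_integral do rewrite /= (gee0_abs (gge0 _)).
exact: iv.
Qed.

Lemma integrable_gR (v : T -> R) : measurable_fun Om v ->
  mu.-integrable Om (g \o v) -> mu.-integrable Om (EFin \o (gR g \o v)).
Proof.
move=> mv; apply: le_integrable => //.
  apply/measurable_EFinP.
  apply: (measurableT_comp (f := @fine R)) => //; exact: measurable_comp_lsc.
move=> x _ /=; rewrite /gR; case: (g (v x)) => [r||] /=; rewrite ?leey //.
Qed.

Lemma integrable_Q (v : T -> R) : inL2 v -> mu.-integrable Om (g \o v) ->
  mu.-integrable Om (EFin \o (fun x => Q x (v x))).
Proof.
move=> Lv iv; have Lva : inL2 (v \- a) by exact: inL2B.
apply: integrable_addR => //; last exact: integrable_gR Lv.1 _.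
apply: integrable_addR => //; first exact: inL2_integrable_mul.
by apply: integrable_scaleR => //; exact: (inL2_integrable_sqr Lva).
Qed.

(** Integrability makes [g (v x)] finite a.e., so the model is a real integral and two of its values
    can be subtracted. *)
Lemma prox_modelE (v : T -> R) : inL2 v -> mu.-integrable Om (g \o v) ->
  prox_model mu Om g f gradf L a v = (f a + \int[mu]_(x in Om) Q x (v x))%:E.
Proof.
move=> Lv iv; have Lva : inL2 (v \- a) by exact: inL2B.
have ig := integrable_gR Lv.1 iv.
have i1 := inL2_integrable_mul mOm Lga Lva.
have i2 := integrable_scaleR mOm (L / 2) (inL2_integrable_sqr Lva).
have -> : \int[mu]_(x in Om) Q x (v x) = L2inner (gradf a) (v \- a) +
    L / 2 * L2norm (v \- a) ^+ 2 + \int[mu]_(x in Om) gR g (v x).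
  rewrite L2norm_sqr -RintegralZl //; last exact: inL2_integrable_sqr.
  rewrite L2innerE -!RintegralD //.
  exact: integrable_addR.
rewrite /prox_model.
have -> : (\int[mu]_(x in Om) g (v x) = \int[mu]_(x in Om) (gR g (v x))%:E)%E.
  apply: ae_eq_integral => //.
  - exact: measurable_comp_lsc Lv.1.
  - by have /integrableP[] := ig.
  - apply: filterS (integrable_ae mOm iv) => x fx Ox; rewrite /gR fineK //.
    exact: fx.
rewrite -[X in (_ + X)%E]fineK; last exact: integrable_fin_num.
by rewrite -EFinD !addrA.
Qed.

Variables (b : T -> R).
Hypotheses (Lb : inL2 b)
  (minb : forall v, inL2 v -> (prox_model mu Om g f gradf L a b <=
     prox_model mu Om g f gradf L a v)%E).

(** The zero function is a competitor of finite value, because [g 0 = 0]. *)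
Lemma integrable_prox_step : mu.-integrable Om (g \o b).
Proof.
apply: integrable_comp_lsc; first exact: Lb.1.
have := minb (inL2_cst mOm finOm 0); rewrite /prox_model.
under [X in (_ <= _ + X)%E]eq_integral do rewrite /= g0.
rewrite integral0 adde0.
by case: (\int[mu]_(x in Om) g (b x))%E => // r; rewrite ltry.
Qed.

Lemma prox_step_le_cst c : g c \is a fin_num ->
  {ae mu, forall x, Om x -> Q x (b x) <= Q x c}.
Proof.
move=> fc.
have ib := integrable_prox_step.
have icst : mu.-integrable Om (g \o cst c).
  have -> : g \o cst c = EFin \o (cst (fine (g c)) : T -> R) :> (T -> \bar R).
    by apply/funext => x /=; rewrite fineK.
  exact: integrable_cstR.
have Lc := inL2_cst mOm finOm c.
have iQb := integrable_Q Lb ib; have iQc := integrable_Q Lc icst.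
have mQ (v : T -> R) : mu.-integrable Om (EFin \o (fun x => Q x (v x))) ->
    measurable_fun Om (fun x => Q x (v x)).
  by move=> /integrableP[/measurable_EFinP].
(* the competitor [v] jumps to [c] exactly where this lowers the integrand *)
pose A x := Q x c < Q x (b x).
have mA : measurable_fun Om A.
  by apply: measurable_fun_ltr; [exact: (mQ _ iQc) | exact: (mQ _ iQb)].
pose v x := if A x then c else b x.
have Lv : inL2 v by exact: inL2_if.
have iv : mu.-integrable Om (g \o v).
  apply: integrable_comp_lsc; first exact: Lv.1.
  have /integrableP[_] := integrableD mOm ib icst; apply: le_lt_trans.
  apply: ge0_le_integral => //.
  - by apply: measurable_comp_lsc; exact: Lv.1.
  - apply: measurableT_comp => //; apply: emeasurable_funD.
      exact: measurable_comp_lsc Lb.1.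
    exact: measurable_comp_lsc Lc.1.
  - move=> x _; rewrite /= gee0_abs ?adde_ge0 //= /v.
    by case: ifP => _; rewrite ?leeDl ?leeDr.
have iQv := integrable_Q Lv iv.
(* This difference is nonnegative everywhere and has integral at most [0] by minimality of [b], so
   it vanishes a.e.; on [A] it is strictly positive. *)
have D0 x : 0 <= Q x (b x) - Q x (v x).
  by rewrite /v; case: ifPn => [/ltW|_]; rewrite ?subrr ?subr_ge0.
have := minb Lv; rewrite !prox_modelE // lee_fin lerD2l -subr_le0 -RintegralB // => le0.
have iD := integrable_subR mOm iQb iQv.
have : (\int[mu]_(x in Om) `|(Q x (b x) - Q x (v x))%:E| = 0)%E.
  under eq_integral do rewrite gee0_abs ?lee_fin //.
  apply/eqP; rewrite eq_le integral_ge0 ?andbT; last by move=> x _; rewrite lee_fin.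
  by rewrite -[X in (X <= _)%E]fineK //; exact: integrable_fin_num.
have /integrableP[mD _] := iD.
move=> /(ae_eq_integral_abs mu mOm mD) .
apply: filterS => x h Ox; have /= [] := h Ox.
by rewrite /v /A; case: ltP => // lt /eqP; rewrite subr_eq0 gt_eqF.
Qed.

(** The null set for a constant competitor depends on the constant. A countable family has a common
    null set, and outside it every [w] in the domain is reached by a limit in which [g] converges
    too. *)
Lemma prox_step_GL : {ae mu, forall x, Om x ->
  GL g L (- gradf a x - L * (b x - a x)) (b x)}.
Proof.
have [c [fc cd]] := countable_graph_dense g0.
have H1 : {ae mu, forall x n, Om x -> Q x (b x) <= Q x (c n)}.
  by apply: ae_foralln => n; exact: prox_step_le_cst.
have H2 := integrable_ae mOm integrable_prox_step.
apply: filterS2 H1 H2 => x h1 h2 Ox.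
apply/GLP => //; split; first exact: h2.
move=> w fw; have [s [cw gw]] := cd w fw.
have : Q x (b x) <= Q x w.
  apply: (@cvgr_to_ge _ \oo _ _ (fun j => Q x (c (s j)))); last first.
    by apply: nearW => j; exact: h1.
  have ca : c (s j) - a x @[j --> \oo] --> w - a x by apply: cvgB => //; exact: cvg_cst.
  apply: cvgD => //; apply: cvgD.
    by apply: cvgM => //; exact: cvg_cst.
  apply: cvgM; first exact: cvg_cst.
  by rewrite expr2; under eq_fun do rewrite expr2; exact: cvgM.
(* Expanding [(w - a)^2] around [b] turns the cross term into a linear one, which is absorbed in
   [z = - gradf a - L (b - a)] and leaves [L/2 (w - b)^2]. *)
rewrite /Q; nra.
Qed.

End prox_step.

(** * Convergence of the iterates *)

(** From index [1] on, the values lie in [{0}], [[t, +oo)] or [(-oo, -t]]. Passing from one piece to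
    another takes a step of length at least [t], and eventually all steps are shorter. *)
Lemma sign_eventually_constant (R : realType) (s : nat -> R) (t : R) : 0 < t ->
  (forall k, s k.+1 != 0 -> t <= `|s k.+1|) ->
  s k.+1 - s k @[k --> \oo] --> 0 ->
  [\/ \forall k \near \oo, s k = 0, \forall k \near \oo, 0 < s k |
      \forall k \near \oo, s k < 0].
Proof.
move=> t0 jump /cvgrPdist_lt/(_ t t0)[N _ HN].
have near_step k : (N <= k)%N -> `|s k.+1 - s k| < t.
  by move=> /HN /=; rewrite sub0r normrN.
have stable (P : R -> Prop) : P (s N.+1) ->
    (forall k, (N < k)%N -> P (s k) -> P (s k.+1)) -> \forall k \near \oo, P (s k).
  (* Starting at [N.+1] excludes [s 0], which is not subject to the gap. *)
  move=> P1 PS; exists N.+1 => // k /=.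
  elim: k => [//|k IH]; rewrite leq_eqVlt => /orP[/eqP <- //|Nk].
  by apply: PS => //; exact: IH.
have step k : (N < k)%N -> (s k = 0 -> s k.+1 = 0) /\
    (0 < s k -> 0 < s k.+1) /\ (s k < 0 -> s k.+1 < 0).
  case: k => // k Nk; have := near_step k.+1 (ltnW Nk).
  rewrite ltr_norml => /andP[lo hi].
  have jk : s k.+1 = 0 \/ t <= s k.+1 \/ s k.+1 <= - t.
    have [->|/jump] := eqVneq (s k.+1) 0; first by left.
    by rewrite ler_normr => /orP[]h; right; [left|right]; lra.
  have jk1 : s k.+2 = 0 \/ t <= s k.+2 \/ s k.+2 <= - t.
    have [->|/jump] := eqVneq (s k.+2) 0; first by left.
    by rewrite ler_normr => /orP[]h; right; [left|right]; lra.
  by split; [|split]; move=> h; case: jk jk1 => [?|[?|?]] [?|[?|?]]; lra.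
have [z|z|z] := ltgtP (s N.+1) 0.
- by apply: Or33; apply: (stable (fun r => r < 0)) => // k /step[_ []].
- by apply: Or32; apply: (stable (fun r => 0 < r)) => // k /step[_ []].
- by apply: Or31; apply: (stable (fun r => r = 0)) => // k /step[].
Qed.

Section prox_gradient.
Context {d : measure_display} {T : measurableType d} {R : realType}.
Variables (mu : {measure set T -> \bar R}) (Om : set T).
Hypotheses (mOm : measurable Om) (finOm : (mu Om < +oo)%E).
Local Notation inL2 := (inL2 mu Om).
Local Notation L2norm := (L2norm mu Om).
Local Notation L2inner := (L2inner mu Om).
Variables (f : (T -> R) -> R) (gradf : (T -> R) -> (T -> R)) (Lf : R).
Variables (g : R -> \bar R) (L : R) (u : nat -> T -> R).
Hypotheses (hA : assumptionA mu Om f gradf Lf) (hB : assumptionB g).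
Hypotheses (hL : Lf < L) (hu : prox_grad_iterates mu Om g f gradf L u).

Let Lu k : inL2 (u k). Proof. by have [] := hu. Qed.
Let gge0 v : (0 <= g v)%E. Proof. by have [_ [_ []]] := hB. Qed.
Let g0 : g 0 = 0%E. Proof. by have [[_ []]] := hB. Qed.
Let lscg : lower_semicontinuous g. Proof. by have [[]] := hB. Qed.

(** The current iterate is a competitor for the next one, with vanishing linear and quadratic terms;
    the descent lemma bounds [f] at the new iterate. The indices start at [k.+1] because the
    integral of [g] may be infinite at the arbitrary [u 0], where [fine] would be meaningless. *)
Lemma sufficient_decrease M k : 0 < M -> Lf <= M ->
  f (u k.+2) + fine (\int[mu]_(x in Om) g (u k.+2 x))%E +
    (L - M) / 2 * L2norm (u k.+2 \- u k.+1) ^+ 2 <=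
  f (u k.+1) + fine (\int[mu]_(x in Om) g (u k.+1 x))%E.
Proof.
move=> M0 LM; have [_ minu] := hu.
have fg n : (\int[mu]_(x in Om) g (u n.+1 x))%E \is a fin_num.
  apply: integrable_fin_num => //.
  exact: (integrable_prox_step mOm finOm lscg g0 gge0 (Lu n.+1) (minu n)).
have dsc := descent_lemma mOm hA M0 LM (Lu k.+1) (Lu k.+2).
have := minu k.+1 _ (Lu k.+1); rewrite /prox_model.
have -> : L2inner (gradf (u k.+1)) (u k.+1 \- u k.+1) = 0.
  rewrite L2innerE; under eq_Rintegral do rewrite /= subrr mulr0.
  by rewrite Rintegral_cst // mul0r.
have -> : L2norm (u k.+1 \- u k.+1) ^+ 2 = 0.
  rewrite L2norm_sqr; under eq_Rintegral do rewrite /= subrr expr0n /=.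
  by rewrite Rintegral_cst // mul0r.
rewrite -(fineK (fg k)) -(fineK (fg k.+1)) -!EFinD lee_fin; lra.
Qed.

Lemma prox_grad_increments_cvg0 :
  {ae mu, forall x, Om x -> u k.+1 x - u k x @[k --> \oo] --> 0}.
Proof.
have [[c hc] [_ [_ [Lf0 _]]]] := hA.
(* The midpoint is positive even if [Lf = 0], and lies strictly below [L], which leaves a positive
   factor in the decrease. *)
pose M := (Lf + L) / 2.
have [M0 LM ML] : [/\ 0 < M, Lf <= M & 0 < (L - M) / 2].
  by move: hL Lf0; rewrite /M => ? ?; split; lra.
pose E k := f (u k.+1) + fine (\int[mu]_(x in Om) g (u k.+1 x))%E.
have Ec k : c <= E k.
  rewrite -[c]addr0; apply: lerD; first exact: hc.
  by rewrite fine_ge0 // integral_ge0.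
have sum_le n : (L - M) / 2 * \sum_(k < n) L2norm (u k.+2 \- u k.+1) ^+ 2 <= E 0 - E n.
  elim: n => [|n IH]; first by rewrite big_ord0 mulr0 subrr.
  rewrite big_ord_recr /= mulrDr.
  have := sufficient_decrease n M0 LM; rewrite -/(E n) -/(E n.+1); lra.
have shifted : {ae mu, forall x, Om x -> u k.+2 x - u k.+1 x @[k --> \oo] --> 0}.
  apply: (@ae_cvg0_of_summable _ _ _ mu _ mOm (fun k => u k.+2 \- u k.+1)
    ((E 0 - c) / ((L - M) / 2))) => [k|n]; first exact: inL2B.
  rewrite ler_pdivlMr // mulrC; apply: le_trans (sum_le n) _.
  by rewrite lerD2l lerN2.
apply: filterS shifted => x H /H.
by rewrite (cvg_shiftS (fun k => u k.+1 x - u k x)).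
Qed.

End prox_gradient.

(** * Pointwise inclusion for the weak limit *)

Lemma increasing_cvgn (phi : nat -> nat) : (forall n, (phi n < phi n.+1)%N) ->
  phi n @[n --> \oo] --> \oo.
Proof.
move=> phiS; have le_phi n : (n <= phi n)%N.
  by elim: n => // n IH; exact: leq_ltn_trans IH (phiS n).
by move=> A [N _ HA]; exists N => // n /= Nn; apply: HA; exact: leq_trans Nn (le_phi n).
Qed.

Theorem theorem4p11 (d : measure_display) (T : measurableType d) (R : realType)
  (mu : {measure set T -> \bar R}) (Om : set T)
  (mOm : measurable Om) (finOm : (mu Om < +oo)%E)
  (f : (T -> R) -> R) (gradf : (T -> R) -> (T -> R)) (Lf : R)
  (g : R -> \bar R) (L : R)
  (hA : assumptionA mu Om f gradf Lf)
  (hB : assumptionB g)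
  (hL : Lf < L) (hs0 : s0 g < L^-1)
  (u : nat -> T -> R) (hu : prox_grad_iterates mu Om g f gradf L u)
  (kn : nat -> nat) (hkn : forall n, (kn n < kn n.+1)%N)
  (ustar : T -> R) (hustar : inL2 mu Om ustar)
  (hweak : L2weak_cvg mu Om (fun n => u (kn n)) ustar)
  (hgrad : {ae mu, forall x, Om x ->
             gradf (u (kn n)) x @[n --> \oo] --> gradf ustar x}) :
  {ae mu, forall x, Om x ->
     (Gzero g L (- gradf ustar x) `|` conv_inf (Gplus g L) (- gradf ustar x)
      `|` conv_inf (Gminus g L) (- gradf ustar x)) (ustar x)}.
Proof.
have [Lu minu] := hu.
have [_ [_ [hD [Lf0 _]]]] := hA.
have [[lscg [gsym g0]] [_ [_ gge0]]] := hB.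
have L0 : 0 < L by exact: le_lt_trans Lf0 hL.
have [t t0 jump] := GL_jump gsym g0 gge0 L0 hB hs0.
have aeGL : {ae mu, forall x k, Om x ->
    GL g L (- gradf (u k) x - L * (u k.+1 x - u k x)) (u k.+1 x)}.
  apply: ae_foralln => k.
  by apply: (prox_step_GL mOm finOm lscg) (minu k) => //; exact: (hD _ _).1.
have aelt := weak_cvg_frequently_lt mOm finOm (fun n => Lu (kn n)) hustar hweak.
have aegt := weak_cvg_frequently_gt mOm finOm (fun n => Lu (kn n)) hustar hweak.
have aed := prox_grad_increments_cvg0 mOm finOm hA hB hL hu.
apply: filterS3 aed hgrad (filterI aeGL (filterI aelt aegt)) => x.
move=> H1 H2 [H3 [H4 H5]] Ox.
have {}H1 := H1 Ox; have {}H2 := H2 Ox.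
have {}H4 := H4 Ox; have {}H5 := H5 Ox; have {}H3 k := H3 k Ox.
have knoo := increasing_cvgn hkn.
pose z n := - gradf (u (kn n)) x - L * (u (kn n).+1 x - u (kn n) x).
have dk : u (kn n).+1 x - u (kn n) x @[n --> \oo] --> 0.
  exact: (cvg_comp _ _ knoo H1).
have zcvg : z n @[n --> \oo] --> - gradf ustar x.
  rewrite -[X in _ --> X]subr0 -[X in _ - X](mulr0 L).
  apply: cvgB; first exact: cvgN.
  by apply: cvgM => //; exact: cvg_cst.
(* Weak convergence controls [u (kn n)], but it is the next iterate that lies in [GL (z n)]: half of
   [e] pays for the increment, half for the weak limit. *)
have inconv (F : R -> set R) : (\forall n \near \oo, F (z n) (u (kn n).+1 x)) ->
    conv_inf F (- gradf ustar x) (ustar x).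
  move=> hF; apply: conv_inf_squeeze => m e e0.
  have m0 : 0 < m.+1%:R^-1 :> R by [].
  have e20 : 0 < e / 2 by rewrite divr_gt0.
  have /cvgrPdist_lt/(_ _ m0) zm := zcvg.
  have /cvgrPdist_lt/(_ _ e20) de := dk.
  have [N _ HN] := filterI hF (filterI zm de).
  have {}HN n : (N <= n)%N -> [/\ F (z n) (u (kn n).+1 x),
      `|z n - - gradf ustar x| < m.+1%:R^-1 & `|u (kn n).+1 x - u (kn n) x| < e / 2].
    by move=> /HN [? [? ?]]; split => //; [rewrite distrC | rewrite -normrN -sub0r].
  split.
    have [n /HN[Fn zn]] := H4 (e / 2) N e20.
    rewrite ltr_norml => /andP[? ?] ?; exists (z n), (u (kn n).+1 x); split => //; lra.
  have [n /HN[Fn zn]] := H5 (e / 2) N e20.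
  rewrite ltr_norml => /andP[? ?] ?; exists (z n), (u (kn n).+1 x); split => //; lra.
have sub (P : R -> Prop) : (\forall k \near \oo, P (u k x)) ->
    \forall n \near \oo, P (u (kn n).+1 x).
  move=> [N _ HN]; have [N' _ HN'] := knoo _ (nbhs_infty_ge N).
  by exists N' => // n /HN' h; apply: HN; exact: leqW h.
have jx k : u k.+1 x != 0 -> t <= `|u k.+1 x| by exact: jump (H3 k).
have [ev0|evp|evn] := sign_eventually_constant t0 jx H1.
(* Iterates that vanish eventually force [ustar x = 0] by the two frequent bounds; optimality of [0]
   then passes to the limit of [z n]. *)
- left; left; have u0 : ustar x = 0.
    have [N _ HN] := knoo _ ev0.
    apply/eqP; rewrite eq_le; apply/andP; split; apply/ler_addgt0Pl => e e0.
      have [n /HN /= -> ] := H5 e N e0; lra.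
    have [n /HN /= -> ] := H4 e N e0; lra.
  split=> //=; rewrite u0; apply: (GL0_closed g0 gge0 zcvg).
  by apply: filterS (sub (fun r => r = 0) ev0) => n E; rewrite -E; exact: H3.
- left; right; apply: inconv.
  by apply: filterS (sub (fun r => 0 < r) evp) => n up; split => //; exact: H3.
- right; apply: inconv.
  by apply: filterS (sub (fun r => r < 0) evn) => n un; split => //; exact: H3.
Qed.
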